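(* Let $a>0$, $a\ne1$, let $\Omega=B_1(0)\subset\mathbb R^2$, $x_0=0$, and in polar coordinates $(r,\theta)$ let $$A(\theta)=\begin{cases}\mathrm{diag}(a,1),&0<\theta<\pi/2,\\ I,&\pi/2<\theta<2\pi.\end{cases}$$ Let $\boldsymbol{\sigma}:=-A\nabla\Phi-\mathbf f_2$ be the modified flux corresponding to the explicit solution $\Phi$ of $-\nabla\cdot(A\nabla\Phi)=\delta_0$ given in the context. Then $$\int_e|\boldsymbol{\sigma}\cdot\mathbf n_e|\,ds=\infty$$ on any straight edge $e$ emanating radially from $x_0$ (with unit normal $\mathbf n_e$), so that the Raviart–Thomas degree of freedom $\int_e\boldsymbol{\sigma}\cdot\mathbf n_e\,ds$ is not defined. The same integral is a degree of freedom of the Brezzi–Douglas–Marini family, so the failure is not particular to the lowest-order Raviart–Thomas space.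
   Context: $\mathbf f_2(x):=\frac1{2\pi}\frac{x}{|x|^2}$. The explicit solution is $\Phi(r,\theta)=-\gamma\log r+U(\theta)$ with $$U(\theta)=\begin{cases}-\dfrac{\gamma}{2}\log\bigl(1+(a-1)\sin^2\theta\bigr)-\dfrac{C_A}{\sqrt a}\arctan(\sqrt a\tan\theta),&0<\theta<\pi/2,\\[4pt]-\dfrac{\gamma}{2}\log a-\dfrac{C_A\pi}{2\sqrt a}-C_A\bigl(\theta-\dfrac{\pi}{2}\bigr),&\pi/2<\theta<2\pi,\end{cases}$$ $$\gamma=\left(\frac{\pi(3+\sqrt a)}{2}+\frac{\sqrt a\,(\log a)^2}{2\pi(3\sqrt a+1)}\right)^{-1},\qquad C_A=-\frac{\sqrt a\,\log a}{\pi(3\sqrt a+1)}\,\gamma .$$ Here $\arctan(\sqrt a\tan\theta)$ is taken continuously on $(0,\pi/2)$. With $f_1=0$ and boundary datum $g=\Phi|_{\partial\Omega}$, $u=\Phi$ solves $-\nabla\cdot(A\nabla u)=f_1+\delta_0$ in $\Omega$, $u=g$ on $\partial\Omega$. On an edge lying on one of the rays $\theta=0$ or $\theta=\pi/2$, $\boldsymbol{\sigma}\cdot\mathbf n_e$ is understood as the one-sided trace from either side. *)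

(* Defs.v *)
From HB Require Import structures.
From mathcomp Require Import all_boot all_order all_algebra.
From mathcomp Require Import all_classical all_reals all_analysis.
Import Order.TTheory GRing.Theory Num.Theory.
Import numFieldNormedType.Exports.

Set Implicit Arguments.
Unset Strict Implicit.
Unset Printing Implicit Defensive.

Local Open Scope classical_set_scope.
Local Open Scope ring_scope.

(* The norm that MathComp-Analysis puts on 'cV[R]_2 is the sup norm (it only
   serves for the topology); lengths are measured with [enorm]. *)
Definition vec2 {R : realType} (x y : R) : 'cV[R]_2 :=
  \col_i (if i == ord0 then x else y).

Definition dot {R : realType} (u v : 'cV[R]_2) : R :=
  \sum_(i < 2) u i ord0 * v i ord0.

Definition enorm {R : realType} (u : 'cV[R]_2) : R := Num.sqrt (dot u u).

Definition det2 {R : realType} (u v : 'cV[R]_2) : R :=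
  u ord0 ord0 * v ord_max ord0 - u ord_max ord0 * v ord0 ord0.

Definition grad {R : realType} (f : 'cV[R]_2 -> R) (x : 'cV[R]_2) : 'cV[R]_2 :=
  \col_i 'D_(delta_mx i ord0) f x.

Definition polar {R : realType} (r theta : R) : 'cV[R]_2 :=
  vec2 (r * cos theta) (r * sin theta).

(* The angle of x in [0, 2 pi[, which is unique if x != 0. *)
Definition polar_angle {R : realType} (x : 'cV[R]_2) : R :=
  xget 0 [set theta | 0 <= theta < 2 * pi /\ x = polar (enorm x) theta].

Definition Omega {R : realType} : set 'cV[R]_2 := [set x | enorm x < 1].

Definition gamma {R : realType} (a : R) : R :=
  (pi * (3 + Num.sqrt a) / 2
   + Num.sqrt a * ln a ^+ 2 / (2 * pi * (3 * Num.sqrt a + 1)))^-1.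

Definition C_A {R : realType} (a : R) : R :=
  - (Num.sqrt a * ln a / (pi * (3 * Num.sqrt a + 1))) * gamma a.

(* The first formula also gives the value at theta = 0, and the second one the
   value at theta = pi / 2; this makes U continuous on the circle. *)
Definition U {R : realType} (a theta : R) : R :=
  if theta < pi / 2 then
    - (gamma a / 2) * ln (1 + (a - 1) * sin theta ^+ 2)
    - C_A a / Num.sqrt a * atan (Num.sqrt a * tan theta)
  else
    - (gamma a / 2) * ln a - C_A a * pi / (2 * Num.sqrt a)
    - C_A a * (theta - pi / 2).

Definition Phi {R : realType} (a : R) (x : 'cV[R]_2) : R :=
  - gamma a * ln (enorm x) + U a (polar_angle x).

(* On the two interface rays, where the coefficient is not specified, the value
   chosen here is immaterial: the flux is only used there through its one-sided
   traces. *)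
Definition coef {R : realType} (a : R) (x : 'cV[R]_2) : 'M[R]_2 :=
  if polar_angle x < pi / 2
  then diag_mx (\row_i (if i == ord0 then a else 1)) else 1%:M.

Definition f2 {R : realType} (x : 'cV[R]_2) : 'cV[R]_2 :=
  (1 / (2 * pi)) *: ((enorm x ^+ 2)^-1 *: x).

Definition modified_flux {R : realType} (a : R) (x : 'cV[R]_2) : 'cV[R]_2 :=
  - (coef a x *m grad (Phi a) x) - f2 x.

Definition interface {R : realType} : set 'cV[R]_2 :=
  [set x | exists r theta : R,
    [/\ 0 < r, theta = 0 \/ theta = pi / 2 & x = polar r theta]].

Definition segment_point {R : realType} (p q : 'cV[R]_2) (t : R) : 'cV[R]_2 :=
  p + t *: (q - p).

Definition open_segment {R : realType} (p q : 'cV[R]_2) : set 'cV[R]_2 :=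
  segment_point p q @` `]0, 1[.

Definition unit_normal {R : realType} (p q n : 'cV[R]_2) : Prop :=
  enorm n = 1 /\ dot n (q - p) = 0.

(* For m normal to an edge through x, the values v (x + h m) with h > 0 are
   taken on the side of the edge into which m points. *)
Definition one_sided {R : realType} (v : 'cV[R]_2 -> 'cV[R]_2)
    (n m x : 'cV[R]_2) : set_system R :=
  dot (v (x + h *: m)) n @[h --> (0 : R)^'+].

(* The normal component v . n, understood on the set Gamma of possible
   discontinuities of v as the trace from the side into which m points. *)
Definition normal_component {R : realType} (Gamma : set 'cV[R]_2)
    (v : 'cV[R]_2 -> 'cV[R]_2) (n m x : 'cV[R]_2) : R :=
  if x \in Gamma then lim (one_sided v n m x) else dot (v x) n.

(* g ds pulled back to the parameter interval of the segment from p to q. *)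
Definition arclength_pullback {R : realType} (p q : 'cV[R]_2)
    (g : 'cV[R]_2 -> R) (t : R) : R :=
  g (segment_point p q t) * enorm (q - p).

Definition edge_integral_abs {R : realType} (p q : 'cV[R]_2)
    (g : 'cV[R]_2 -> R) : \bar R :=
  (\int[lebesgue_measure]_(t in `]0%R, 1%R[)
     (arclength_pullback p q (fun x => `|g x|%R) t)%:E)%E.

(* Degrees of freedom are partial functionals: None where the Lebesgue integral
   defining them does not exist as a real number. *)
Definition partial_integral {R : realType} (d : measure_display)
    (T : measurableType d) (mu : {measure set T -> \bar R})
    (D : set T) (f : T -> R) : option R :=
  if `[< mu.-integrable D (EFin \o f) >] then Some (Rintegral mu D f) else None.

Definition functional (R : realType) : Type :=
  ('cV[R]_2 -> 'cV[R]_2) -> option R.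

Definition edge_moment {R : realType} (Gamma : set 'cV[R]_2)
    (p q n m : 'cV[R]_2) (w : 'cV[R]_2 -> R) : functional R :=
  fun v => partial_integral lebesgue_measure `]0, 1[
    (arclength_pullback p q (fun x => normal_component Gamma v n m x * w x)).

Definition edge_flux {R : realType} (Gamma : set 'cV[R]_2)
    (p q n m : 'cV[R]_2) : functional R :=
  edge_moment Gamma p q n m (fun=> 1).

Definition cell_moment {R : realType} (K : set 'cV[R]_2)
    (w : 'cV[R]_2 -> 'cV[R]_2) : functional R :=
  fun v => partial_integral (lebesgue_measure \x lebesgue_measure)%E
    [set z : R * R | K (vec2 z.1 z.2)]
    (fun z : R * R => dot (v (vec2 z.1 z.2)) (w (vec2 z.1 z.2))).

(* Polynomial functions of total degree < d; P_k is [poly_fun k.+1]. *)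
Definition poly_fun {R : realType} (d : nat) : set ('cV[R]_2 -> R) :=
  [set f | exists c : nat -> nat -> R, forall x : 'cV[R]_2,
     f x = \sum_(i < d) \sum_(j < (d - i)%N)
             c i j * x ord0 ord0 ^+ i * x ord_max ord0 ^+ j].

(* The barycentric coordinate of the vertex r in the triangle p q r. *)
Definition barycentric {R : realType} (p q r x : 'cV[R]_2) : R :=
  det2 (q - p) (x - p) / det2 (q - p) (r - p).

Definition triangle {R : realType} (p q r : 'cV[R]_2) : set 'cV[R]_2 :=
  [set x | [/\ 0 <= barycentric p q r x, 0 <= barycentric q r p x
             & 0 <= barycentric r p q x]].

Definition bubble {R : realType} (p q r x : 'cV[R]_2) : R :=
  barycentric p q r x * barycentric q r p x * barycentric r p q x.

Definition curl {R : realType} (f : 'cV[R]_2 -> R) (x : 'cV[R]_2) : 'cV[R]_2 :=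
  vec2 (grad f x ord_max ord0) (- grad f x ord0 ord0).

(* Moments of v . n against the weights W on the edges of the triangle p q r;
   the unit normal n of an edge x y may have either orientation, while m points
   to the opposite vertex z: traces are taken from inside the triangle. *)
Definition edge_moments {R : realType} (Gamma : set 'cV[R]_2)
    (W : set ('cV[R]_2 -> R)) (p q r : 'cV[R]_2) : set (functional R) :=
  [set l | exists x y z n m w,
     [/\ (x, y, z) \in [:: (p, q, r); (q, r, p); (r, p, q)],
         unit_normal x y n,
         m = n \/ m = - n,
         0 < dot m (z - x)
       & W w /\ l = edge_moment Gamma x y n m w]].

Definition RT0_dofs {R : realType} (Gamma : set 'cV[R]_2) (p q r : 'cV[R]_2) :
    set (functional R) :=
  edge_moments Gamma [set (fun=> 1)] p q r.

(* BDM_k for k >= 1: edge moments against P_k, and interior moments against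
   grad P_{k-1} and curl (b P_{k-2}) with b the cubic bubble (P_{-1} = 0). *)
Definition BDM_dofs {R : realType} (Gamma : set 'cV[R]_2) (k : nat)
    (p q r : 'cV[R]_2) : set (functional R) :=
  edge_moments Gamma (poly_fun k.+1) p q r
  `|` [set cell_moment (triangle p q r) (grad f) | f in poly_fun k]
  `|` [set cell_moment (triangle p q r) (curl (fun x => bubble p q r x * f x))
      | f in poly_fun k.-1].

(* Main.v *)
Require Import Defs.
From HB Require Import structures.
From mathcomp Require Import all_boot all_order all_algebra.
From mathcomp Require Import all_classical all_reals all_analysis.
From mathcomp Require Import measurable_realfun ring lra.
Import Order.TTheory GRing.Theory Num.Theory.
Import numFieldNormedType.Exports.
Local Open Scope classical_set_scope.
Local Open Scope ring_scope.

(** In polar coordinates the gradient of [Phi] has radial part [- gamma / r] and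
    angular part [U' / r].  The angular profile [U] is built so that the
    conormal derivative of [Phi] across a ray does not depend on the ray: with
    [n] the unit angular vector, [A grad Phi . n = - C_A / r] in both sectors,
    because the term [(a - 1) gamma cos sin / r], by which the anisotropy
    couples [n] to the radial part of the gradient, cancels against the
    logarithmic term of [U].  The field [f2] is radial, hence
    [sigma . n = C_A / r] on every ray, and [C_A] is a nonzero multiple of
    [ln a].  So along any radial edge [|sigma . n|] integrates to
    [|C_A| * int_0^1 dt / t = +oo], after rescaling the edge to the unit
    interval.

    Derivatives of the polar angle are obtained from three charts: up to sign
    and an additive constant, the angle is the arctangent of [y / x] on the
    first quadrant and on the half-plane [x < 0], and of [x / y] on the
    half-plane [y < 0]; these cover the plane minus the origin and the two
    interface rays.  In each chart [Phi] takes the form [chart_potential],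
    [- (g / 2) ln (x^2 + b y^2) - C / sqrt b * atan (sqrt b * y / x) + k] with
    [b = a] on the quadrant and [b = 1] elsewhere ([x] and [y] being exchanged,
    and the sign of [C] reversed, when [y < 0]).  Consequently a single rational
    expression, [flux_component], describes the flux on both sides
    ([modified_flux_quadrant], [modified_flux_outside]).  It extends
    continuously across the interface rays, where its value in the normal
    direction is independent of [b] ([flux_component_normal]); therefore the
    one-sided traces exist, agree, and obey the same formula [C_A / r] as on
    the other rays ([normal_component_trace]). *)

(** * Plane vectors in coordinates *)

Lemma vec2_coords {R : realType} (x : 'cV[R]_2) :
  x = vec2 (x ord0 ord0) (x ord_max ord0).
Proof.
apply/matrixP => i j; rewrite !mxE [j]ord1.
by case: i => [[|[|//]] hi]; congr (x _ _); apply: val_inj.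
Qed.

Lemma dot_vec2 {R : realType} (x y u v : R) :
  dot (vec2 x y) (vec2 u v) = x * u + y * v.
Proof. by rewrite /dot !big_ord_recl big_ord0 !mxE /= addr0. Qed.

Lemma add_vec2 {R : realType} (x y u v : R) :
  vec2 x y + vec2 u v = vec2 (x + u) (y + v).
Proof. by apply/matrixP => i j; rewrite !mxE; case: ifP. Qed.

Lemma scale_vec2 {R : realType} (k x y : R) :
  k *: vec2 x y = vec2 (k * x) (k * y).
Proof. by apply/matrixP => i j; rewrite !mxE; case: ifP. Qed.

Lemma opp_vec2 {R : realType} (x y : R) : - vec2 x y = vec2 (- x) (- y).
Proof. by apply/matrixP => i j; rewrite !mxE; case: ifP. Qed.

Lemma vec2_inj {R : realType} (x y u v : R) :
  vec2 x y = vec2 u v -> x = u /\ y = v.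
Proof.
move=> /matrixP E.
by move: (E ord0 ord0) (E ord_max ord0); rewrite !mxE.
Qed.

Lemma delta_mx0_vec2 {R : realType} : delta_mx ord0 ord0 = vec2 (1 : R) 0.
Proof. by rewrite [LHS]vec2_coords !mxE /=. Qed.

Lemma delta_mx1_vec2 {R : realType} : delta_mx ord_max ord0 = vec2 (0 : R) 1.
Proof. by rewrite [LHS]vec2_coords !mxE /=. Qed.

Lemma enorm_sqr {R : realType} (x y : R) :
  enorm (vec2 x y) ^+ 2 = x ^+ 2 + y ^+ 2.
Proof.
by rewrite /enorm dot_vec2 sqr_sqrtr ?expr2// addr_ge0// -expr2 sqr_ge0.
Qed.

Lemma enorm_ge0 {R : realType} (x : 'cV[R]_2) : 0 <= enorm x.
Proof. exact: sqrtr_ge0. Qed.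

Lemma sqr_add_gt0 {R : realType} (b x y : R) : 0 < b -> x != 0 \/ y != 0 ->
  0 < x ^+ 2 + b * y ^+ 2.
Proof.
move=> b0 [h|h].
  by rewrite ltr_pwDl ?exprn_even_gt0// mulr_ge0 ?sqr_ge0// ltW.
by rewrite ltr_wpDl ?sqr_ge0// mulr_gt0// exprn_even_gt0.
Qed.

Lemma enorm_gt0 {R : realType} (q : 'cV[R]_2) : q != 0 -> 0 < enorm q.
Proof.
move=> q0; rewrite lt_def enorm_ge0 andbT; apply: contraNneq q0 => e0.
have := enorm_sqr (q ord0 ord0) (q ord_max ord0).
rewrite -vec2_coords e0 expr0n => /esym/eqP.
rewrite paddr_eq0 ?sqr_ge0// !expf_eq0/= => /andP[/eqP x0 /eqP y0].
by apply/eqP; rewrite [LHS]vec2_coords [RHS]vec2_coords x0 y0 !mxE.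
Qed.

(** Lagrange's identity [det^2 + dot^2 = |q|^2 |n|^2]. *)
Lemma det2_normal {R : realType} (q n : 'cV[R]_2) :
  enorm n = 1 -> dot n q = 0 -> `|det2 q n| = enorm q.
Proof.
move=> n1 ort; apply/eqP; rewrite -(@eqrXn2 _ 2)// ?enorm_ge0//; apply/eqP.
rewrite real_normK ?num_real//.
have : enorm n ^+ 2 = 1 by rewrite n1 expr1n.
move: ort; rewrite [q]vec2_coords [n]vec2_coords /det2 dot_vec2 !enorm_sqr.
rewrite !mxE/=.
move: (n ord0 _) (n ord_max _) (q ord0 _) (q ord_max _) => u v x y ort uv1.
transitivity
  ((x ^+ 2 + y ^+ 2) * (u ^+ 2 + v ^+ 2) - (u * x + v * y) ^+ 2); first ring.
by rewrite ort uv1 expr0n subr0 mulr1.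
Qed.

Lemma grad_vec2 {R : realType} (f : 'cV[R]_2 -> R) (x : 'cV[R]_2) :
  grad f x = vec2 ('D_(vec2 1 0) f x) ('D_(vec2 0 1) f x).
Proof.
by rewrite -delta_mx0_vec2 -delta_mx1_vec2 [LHS]vec2_coords !mxE.
Qed.

Lemma diag_mx_vec2 {R : realType} (c x y : R) :
  diag_mx (\row_i (if i == ord0 then c else 1)) *m vec2 x y = vec2 (c * x) y.
Proof.
by rewrite mul_diag_mx [LHS]vec2_coords !mxE /= mul1r.
Qed.

(** * The polar angle *)

Lemma enorm_polar {R : realType} (r t : R) : 0 <= r -> enorm (polar r t) = r.
Proof.
move=> r0; apply/eqP; rewrite -(@eqrXn2 _ 2)// ?enorm_ge0//; apply/eqP.
rewrite enorm_sqr.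
transitivity (r ^+ 2 * (cos t ^+ 2 + sin t ^+ 2)); first ring.
by rewrite cos2Dsin2 mulr1.
Qed.

(** If [cos (t - s) = 1] then [sin ((t - s) / 2)] vanishes, which is impossible
    for [0 < t - s < 2 pi]. *)
Lemma cossin_inj {R : realType} (s t : R) :
  0 <= s < 2 * pi -> 0 <= t < 2 * pi -> cos s = cos t -> sin s = sin t -> s = t.
Proof.
wlog st : s t / s <= t.
  move=> H hs ht cc ss; have [/H|/ltW/H] := leP s t; first exact.
  by move=> /(_ ht hs (esym cc) (esym ss)).
move=> /andP[s0 s2] /andP[t0 t2] cc ss.
apply/eqP; rewrite eq_le st leNgt; apply/negP => lst.
have p0 := @pi_gt0 R.
set d := (t - s) / 2.
have d0 : 0 < sin d by apply: sin_gt0_pi; rewrite /d; apply/andP; split; lra.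
have : cos (t - s) = 1 by rewrite cosB cc ss -!expr2 cos2Dsin2.
have -> : t - s = d *+ 2 by rewrite /d mulr2n; field.
rewrite cos_mulr2n cos2sin2 => e.
have : 0 < sin d ^+ 2 by rewrite exprn_gt0.
lra.
Qed.

Lemma polar_angle_polar {R : realType} (r t : R) :
  0 < r -> 0 <= t < 2 * pi -> polar_angle (polar r t) = t.
Proof.
move=> r0 ht; rewrite /polar_angle enorm_polar ?ltW//.
case: xgetP => [s -> [hs /vec2_inj[]]|/(_ t)[]//].
move=> /(mulfI (lt0r_neq0 r0)) ? /(mulfI (lt0r_neq0 r0)) ?.
exact: cossin_inj.
Qed.

Lemma cos_atan_gt0 {R : realType} (t : R) : 0 < cos (atan t).
Proof. by rewrite cos_atan invr_gt0 sqrtr_gt0 ltr_pwDl// sqr_ge0. Qed.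

Lemma sin_atan {R : realType} (t : R) : sin (atan t) = t * cos (atan t).
Proof. by rewrite -[X in X * _]atanK /tan divfK// lt0r_neq0// cos_atan_gt0. Qed.

(** The three charts below are [theta = atan (y / x)] for [x > 0],
    [theta = atan (y / x) + pi] for [x < 0] and
    [theta = 3 pi / 2 - atan (x / y)] for [y < 0].  The radius is written as a
    quotient by the cosine, so that each identity reduces to
    [sin (atan t) = t * cos (atan t)]. *)
Lemma polar_right {R : realType} (x y : R) :
  0 < x -> vec2 x y = polar (x / cos (atan (y / x))) (atan (y / x)).
Proof.
move=> x0; have c0 := cos_atan_gt0 (y / x).
by rewrite /polar sin_atan; congr vec2; field; rewrite !gt_eqF.
Qed.

Lemma polar_left {R : realType} (x y : R) :
  x < 0 -> vec2 x y = polar (- x / cos (atan (y / x))) (atan (y / x) + pi).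
Proof.
move=> x0; have c0 := cos_atan_gt0 (y / x).
rewrite /polar sinDpi cosDpi sin_atan; congr vec2; field;
  by rewrite ?(gt_eqF c0) ?(lt_eqF x0).
Qed.

Lemma polar_lower {R : realType} (x y : R) :
  y < 0 ->
  vec2 x y = polar (- y / cos (atan (x / y))) (pi / 2 + pi - atan (x / y)).
Proof.
move=> y0; have c0 := cos_atan_gt0 (x / y).
rewrite /polar [pi / 2 + pi - _]addrAC sinDpi cosDpi addrC.
rewrite cosDpihalf sinDpihalf.
rewrite sinN cosN sin_atan; congr vec2; field;
  by rewrite ?(gt_eqF c0) ?(lt_eqF y0).
Qed.

Lemma polar_angle_quadrant {R : realType} (x y : R) :
  0 < x -> 0 < y ->
  polar_angle (vec2 x y) = atan (y / x) /\ 0 < atan (y / x) < pi / 2.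
Proof.
move=> x0 y0; have p0 := @pi_gt0 R.
have b : 0 < atan (y / x) < pi / 2.
  by rewrite atan_ltpi2 -[X in X < _]atan0 lt_atan ?divr_gt0.
split=> //; rewrite polar_right// polar_angle_polar//.
  by rewrite divr_gt0// cos_atan_gt0.
by move: b => /andP[? ?]; apply/andP; split; lra.
Qed.

Lemma polar_angle_left {R : realType} (x y : R) :
  x < 0 ->
  polar_angle (vec2 x y) = atan (y / x) + pi /\ pi / 2 < atan (y / x) + pi.
Proof.
move=> x0; have p0 := @pi_gt0 R.
have := atan_ltpi2 (y / x); have := atan_gtNpi2 (y / x) => ? ?.
split; last lra.
rewrite polar_left// polar_angle_polar//.
  by rewrite divr_gt0// ?oppr_gt0// cos_atan_gt0.
by apply/andP; split; lra.
Qed.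

Lemma polar_angle_lower {R : realType} (x y : R) :
  y < 0 -> polar_angle (vec2 x y) = pi / 2 + pi - atan (x / y) /\
  pi / 2 < pi / 2 + pi - atan (x / y).
Proof.
move=> y0; have p0 := @pi_gt0 R.
have := atan_ltpi2 (x / y); have := atan_gtNpi2 (x / y) => ? ?.
split; last lra.
rewrite polar_lower// polar_angle_polar//.
  by rewrite divr_gt0// ?oppr_gt0// cos_atan_gt0.
by apply/andP; split; lra.
Qed.

(** * The potential in the charts *)

Lemma ln_enorm {R : realType} (x y : R) : x != 0 \/ y != 0 ->
  ln (enorm (vec2 x y)) = ln (x ^+ 2 + y ^+ 2) / 2.
Proof.
move=> h; have := sqr_add_gt0 1 x y ltr01 h; rewrite mul1r -enorm_sqr => e0.
have e1 : 0 < enorm (vec2 x y).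
  rewrite lt_def enorm_ge0 andbT; apply: contraTneq e0 => ->.
  by rewrite expr0n ltxx.
by rewrite lnXn// mulr2n; field.
Qed.

(** Up to a constant, this is [- g ln |z| - (C / sqrt b) arg z] in the stretched
    coordinates [z = (x, sqrt b * y)], in which the operator
    [div (diag (b, 1) grad)] becomes a multiple of the Laplacian. *)
Definition chart_potential {R : realType} (g C b k x y : R) : R :=
  - (g / 2) * ln (x ^+ 2 + b * y ^+ 2)
  - C / Num.sqrt b * atan (Num.sqrt b * (y / x)) + k.

(** Here [r^2 (1 + (a - 1) sin^2 theta) = x^2 + a y^2], so the two logarithms
    combine. *)
Lemma Phi_quadrant {R : realType} (a x y : R) : 0 < a -> 0 < x -> 0 < y ->
  Phi a (vec2 x y) = chart_potential (gamma a) (C_A a) a 0 x y.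
Proof.
move=> a0 x0 y0; have [e /andP[_ b2]] := polar_angle_quadrant x y x0 y0.
have xy0 : x != 0 \/ y != 0 by left; rewrite gt_eqF.
rewrite /Phi e /U b2 ln_enorm// atanK /chart_potential addr0.
have E0 := sqr_add_gt0 1 x y ltr01 xy0; rewrite mul1r in E0.
have Ea := sqr_add_gt0 a x y a0 xy0.
have -> : 1 + (a - 1) * sin (atan (y / x)) ^+ 2
    = (x ^+ 2 + a * y ^+ 2) / (x ^+ 2 + y ^+ 2).
  rewrite sin2cos2 cos_atan exprVn sqr_sqrtr ?addr_ge0 ?sqr_ge0//.
  have h : 1 + (y / x) ^+ 2 = (x ^+ 2 + y ^+ 2) / x ^+ 2.
    by field; rewrite gt_eqF.
  by rewrite h; field; rewrite !gt_eqF.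
rewrite ln_div ?posrE//; field.
by rewrite gt_eqF// sqrtr_gt0.
Qed.

Lemma Phi_left {R : realType} (a : R) : exists k, forall x y : R, x < 0 ->
  Phi a (vec2 x y) = chart_potential (gamma a) (C_A a) 1 k x y.
Proof.
exists (- (gamma a / 2) * ln a - C_A a * pi / (2 * Num.sqrt a)
        - C_A a * pi / 2).
move=> x y x0; have [e h] := polar_angle_left x y x0.
rewrite /Phi e /U ltNge (ltW h)/= ln_enorm; last by left; rewrite lt_eqF.
by rewrite /chart_potential sqrtr1 !mul1r divr1; set c := _ / (2 * _); field.
Qed.

(** Taking [x / y] as the argument of the arctangent exchanges the roles of the
    coordinates and reverses the orientation of the angle, whence [- C_A]. *)
Lemma Phi_lower {R : realType} (a : R) : exists k, forall x y : R, y < 0 ->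
  Phi a (vec2 x y) = chart_potential (gamma a) (- C_A a) 1 k y x.
Proof.
exists (- (gamma a / 2) * ln a - C_A a * pi / (2 * Num.sqrt a) - C_A a * pi).
move=> x y y0; have [e h] := polar_angle_lower x y y0.
rewrite /Phi e /U ltNge (ltW h)/= ln_enorm; last by right; rewrite lt_eqF.
rewrite /chart_potential sqrtr1 !mul1r divr1 [y ^+ 2 + _]addrC.
by set c := _ / (2 * _); field.
Qed.

(** * Directional derivatives of the potential *)

Lemma derive_line {R : realType} (f : 'cV[R]_2 -> R) (x v : 'cV[R]_2) :
  'D_v f x = 'D_1 (fun h : R => f (x + h *: v)) 0.
Proof.
rewrite /derive.
suff -> : (fun h : R => h^-1 *: ((f \o shift x) (h *: v) - f x)) =
  (fun h : R => h^-1 *: (((fun h => f (x + h *: v)) \o shift 0) (h *: 1)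
                          - f (x + 0 *: v))) by [].
apply/funext => h /=.
congr (_ *: (f _ - f _)); last by rewrite scale0r addr0.
by rewrite addr0 addrC -[X in X *: v]mulr1.
Qed.

Lemma is_derive_affine {R : realType} (x u : R) :
  is_derive (0 : R) (1 : R) (fun h => x + h * u) u.
Proof.
have -> : (fun h => x + h * u) = cst x + u \*: id.
  by apply/funext => h; rewrite !fctE mulrC.
by apply: is_derive_eq; rewrite add0r -[_ *: _]/(_ * _) mulr1.
Qed.

Lemma derive_chart_potential {R : realType} (g C b k x y u v : R) :
  0 < b -> x != 0 ->
  is_derive (0 : R) (1 : R)
    (fun h => chart_potential g C b k (x + h * u) (y + h * v))
    (- (g * (x * u + b * y * v) + C * (x * v - y * u)) / (x ^+ 2 + b * y ^+ 2)).
Proof.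
move=> b0 x0.
have E0 := sqr_add_gt0 b x y b0 (or_introl x0).
set X := fun h : R => x + h * u; set Y := fun h : R => y + h * v.
have dX : is_derive (0 : R) (1 : R) X u := is_derive_affine x u.
have dY : is_derive (0 : R) (1 : R) Y v := is_derive_affine y v.
have X0 : X 0 = x by rewrite /X mul0r addr0.
have Y0 : Y 0 = y by rewrite /Y mul0r addr0.
have dV : is_derive (0 : R) (1 : R) (fun h => (X h)^-1) (- x ^- 2 *: u).
  by rewrite -X0; apply: is_deriveV => //; rewrite X0.
pose E := X ^+ 2 + b \*: Y ^+ 2.
pose T := Num.sqrt b \*: (Y * (fun h => (X h)^-1)).
have dE : is_derive (0 : R) (1 : R) E (2 * x * u + b * (2 * y * v)).
  apply: is_derive_eq; rewrite /= X0 Y0 !expr1 /GRing.scale/=; ring.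
have dT : is_derive (0 : R) (1 : R) T (Num.sqrt b * ((x * v - y * u) / x ^+ 2)).
  apply: is_derive_eq; rewrite /= X0 ?Y0.
  by rewrite /GRing.scale/=; field.
have EE : E 0 = x ^+ 2 + b * y ^+ 2 by rewrite -X0 -Y0.
have TE : T 0 = Num.sqrt b * (y / x) by rewrite -X0 -Y0.
have dl : is_derive (E 0) (1 : R) (@ln R) (E 0)^-1.
  by apply: is_derive1_ln; rewrite EE.
have -> : (fun h => chart_potential g C b k (x + h * u) (y + h * v)) =
   - (g / 2) \*: (@ln R \o E) - C / Num.sqrt b \*: (@atan R \o T) + cst k.
  by apply/funext => h.
apply: is_derive_eq; rewrite EE TE /GRing.scale/= exprMn sqr_sqrtr ?ltW//.
have h : 1 + b * (y / x) ^+ 2 = (x ^+ 2 + b * y ^+ 2) / x ^+ 2 by field.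
rewrite h; field.
by rewrite (gt_eqF E0) x0 gt_eqF ?sqrtr_gt0.
Qed.

(** Only the restriction of [f] to a short segment around [x] matters, hence an
    expression valid in one chart can be differentiated in place of [Phi]. *)
Lemma derive_along_line {R : realType} (f : 'cV[R]_2 -> R) (F : R -> R)
    (x v : 'cV[R]_2) (d : R) :
  (\forall h \near (0 : R), F h = f (x + h *: v)) ->
  is_derive (0 : R) (1 : R) F d -> 'D_v f x = d.
Proof.
by rewrite derive_line => Ff dF; have [_ ->] := near_eq_is_derive Ff dF.
Qed.

Lemma cvg_affine {R : realType} (x u : R) : x + h * u @[h --> (0 : R)] --> x.
Proof.
rewrite -[X in _ --> X]addr0 -[X in _ + X](mul0r u).
apply: cvgD; first exact: cvg_cst.
by apply: cvgM; [exact: cvg_id|exact: cvg_cst].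
Qed.

Lemma near_affine_gt0 {R : realType} (x u : R) :
  0 < x -> \forall h \near (0 : R), 0 < x + h * u.
Proof. by move=> x0; apply: cvgr_gt (cvg_affine x u) _ x0. Qed.

Lemma near_affine_lt0 {R : realType} (x u : R) :
  x < 0 -> \forall h \near (0 : R), x + h * u < 0.
Proof. by move=> x0; apply: cvgr_lt (cvg_affine x u) _ x0. Qed.

Lemma derive_Phi_quadrant {R : realType} (a x y u v : R) :
  0 < a -> 0 < x -> 0 < y ->
  'D_(vec2 u v) (Phi a) (vec2 x y) =
  - (gamma a * (x * u + a * y * v) + C_A a * (x * v - y * u))
    / (x ^+ 2 + a * y ^+ 2).
Proof.
move=> a0 x0 y0.
have x1 : x != 0 by rewrite gt_eqF.
have D := derive_chart_potential (gamma a) (C_A a) a 0 x y u v a0 x1.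
apply: derive_along_line D.
near=> h; rewrite scale_vec2 add_vec2 Phi_quadrant//.
  by near: h; exact: near_affine_gt0.
by near: h; exact: near_affine_gt0.
Unshelve. all: by end_near. Qed.

Lemma derive_Phi_outside {R : realType} (a x y u v : R) : x < 0 \/ y < 0 ->
  'D_(vec2 u v) (Phi a) (vec2 x y) =
  - (gamma a * (x * u + y * v) + C_A a * (x * v - y * u)) / (x ^+ 2 + y ^+ 2).
Proof.
move=> [x0|y0].
  have [k Pk] := Phi_left a; have x1 : x != 0 by rewrite lt_eqF.
  have D := derive_chart_potential (gamma a) (C_A a) 1 k x y u v ltr01 x1.
  have -> : - (gamma a * (x * u + y * v) + C_A a * (x * v - y * u))
      / (x ^+ 2 + y ^+ 2) =
    - (gamma a * (x * u + 1 * y * v) + C_A a * (x * v - y * u))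
      / (x ^+ 2 + 1 * y ^+ 2) by rewrite !mul1r.
  apply: derive_along_line D.
  near=> h; rewrite scale_vec2 add_vec2 Pk//.
  by near: h; exact: near_affine_lt0.
have [k Pk] := Phi_lower a; have y1 : y != 0 by rewrite lt_eqF.
have D := derive_chart_potential (gamma a) (- C_A a) 1 k y x v u ltr01 y1.
have -> : - (gamma a * (x * u + y * v) + C_A a * (x * v - y * u))
    / (x ^+ 2 + y ^+ 2) =
  - (gamma a * (y * v + 1 * x * u) + - C_A a * (y * u - x * v))
    / (y ^+ 2 + 1 * x ^+ 2).
  by rewrite !mul1r [y ^+ 2 + _]addrC; congr (_ / _); ring.
apply: derive_along_line D.
near=> h; rewrite scale_vec2 add_vec2 Pk//.
by near: h; exact: near_affine_lt0.
Unshelve. all: by end_near. Qed.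

(** * The modified flux *)

(** The component along [(u, v)] of [- diag (b, 1) grad P - f2], where [P] is
    the chart potential; as a rational expression it makes sense on the
    interface rays too. *)
Definition flux_component {R : realType} (a b x y u v : R) : R :=
  (b * (gamma a * x - C_A a * y) * u + (b * gamma a * y + C_A a * x) * v)
    / (x ^+ 2 + b * y ^+ 2)
  - (x * u + y * v) / (2 * pi * (x ^+ 2 + y ^+ 2)).

Lemma dot_modified_flux {R : realType} (a b x y u v p q : R) :
  coef a (vec2 x y) *m grad (Phi a) (vec2 x y) = vec2 (b * p) q ->
  dot (modified_flux a (vec2 x y)) (vec2 u v) =
  - (b * p * u + q * v) - (x * u + y * v) / (2 * pi * (x ^+ 2 + y ^+ 2)).
Proof.
move=> e; rewrite /modified_flux e /f2 enorm_sqr !scale_vec2 !opp_vec2 add_vec2.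
by rewrite dot_vec2 div1r [(2 * pi * _)^-1]invfM; ring.
Qed.

Lemma modified_flux_quadrant {R : realType} (a x y u v : R) :
  0 < a -> 0 < x -> 0 < y ->
  dot (modified_flux a (vec2 x y)) (vec2 u v) = flux_component a a x y u v.
Proof.
move=> a0 x0 y0; have [e /andP[_ b2]] := polar_angle_quadrant x y x0 y0.
have Ea := sqr_add_gt0 a x y a0 (or_introl (lt0r_neq0 x0)).
have H : coef a (vec2 x y) *m grad (Phi a) (vec2 x y) =
    vec2 (a * 'D_(vec2 1 0) (Phi a) (vec2 x y))
         ('D_(vec2 0 1) (Phi a) (vec2 x y)).
  by rewrite /coef e b2 grad_vec2 diag_mx_vec2.
rewrite (dot_modified_flux _ _ _ _ _ _ _ _ H) !derive_Phi_quadrant//.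
by rewrite /flux_component; congr (_ - _); field; rewrite gt_eqF.
Qed.

Lemma modified_flux_outside {R : realType} (a x y u v : R) : x < 0 \/ y < 0 ->
  dot (modified_flux a (vec2 x y)) (vec2 u v) = flux_component a 1 x y u v.
Proof.
move=> xy0.
have xy1 : x != 0 \/ y != 0 by case: xy0 => h; [left|right]; rewrite lt_eqF.
have E0 := sqr_add_gt0 1 x y ltr01 xy1; rewrite mul1r in E0.
have H : coef a (vec2 x y) *m grad (Phi a) (vec2 x y) =
    vec2 (1 * 'D_(vec2 1 0) (Phi a) (vec2 x y))
         ('D_(vec2 0 1) (Phi a) (vec2 x y)).
  rewrite /coef ifF; last first.
    apply/negbTE; rewrite -leNgt.
    by case: xy0 =>
      [/(polar_angle_left x y)|/(polar_angle_lower x y)] [-> /ltW].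
  by rewrite mul1mx grad_vec2 mul1r.
rewrite (dot_modified_flux _ _ _ _ _ _ _ _ H) !derive_Phi_outside//.
by rewrite /flux_component; congr (_ - _); field; rewrite gt_eqF.
Qed.

(** The difference of the two sides, over a common denominator, is a multiple of
    [x * u + y * v]: this is the cancellation that makes the normal flux
    independent of [b]. *)
Lemma flux_component_normal {R : realType} (a b x y u v : R) :
  0 < b -> x != 0 \/ y != 0 -> x * u + y * v = 0 ->
  flux_component a b x y u v = C_A a * (x * v - y * u) / (x ^+ 2 + y ^+ 2).
Proof.
move=> b0 xy0 ort; have Eb := sqr_add_gt0 b x y b0 xy0.
have E1 := sqr_add_gt0 1 x y ltr01 xy0; rewrite mul1r in E1.
rewrite /flux_component ort mul0r subr0.
apply/eqP; rewrite eqr_div ?lt0r_neq0// -subr_eq0; apply/eqP.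
transitivity ((x * u + y * v) *
  (b * gamma a * (x ^+ 2 + y ^+ 2) + (1 - b) * C_A a * x * y)); first by ring.
by rewrite ort mul0r.
Qed.

Lemma cvg_flux_component {R : realType} (a b x y m1 m2 u v : R) :
  0 < b -> x != 0 \/ y != 0 ->
  flux_component a b (x + h * m1) (y + h * m2) u v @[h --> (0 : R)]
    --> flux_component a b x y u v.
Proof.
move=> b0 xy0; have Eb := sqr_add_gt0 b x y b0 xy0.
have E1 := sqr_add_gt0 1 x y ltr01 xy0; rewrite mul1r in E1.
have cX := cvg_affine x m1; have cY := cvg_affine y m2.
have cst (k : R) : (fun=> k) @ (0 : R) --> k by exact: cvg_cst.
have cQ (c : R) : (x + h * m1) ^+ 2 + c * (y + h * m2) ^+ 2 @[h --> (0 : R)]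
    --> x ^+ 2 + c * y ^+ 2.
  by apply: cvgD; [|apply: cvgM; first exact: cst]; apply: cvgM.
have cL (c d : R) : c * (x + h * m1) + d * (y + h * m2) @[h --> (0 : R)]
    --> c * x + d * y.
  by apply: cvgD; apply: cvgM.
have cN (c d c' d' : R) : (c * (x + h * m1) + d * (y + h * m2)) * u +
   (c' * (x + h * m1) + d' * (y + h * m2)) * v @[h --> (0 : R)]
    --> (c * x + d * y) * u + (c' * x + d' * y) * v.
  by apply: cvgD; apply: cvgM.
have fE (X Y : R) : flux_component a b X Y u v =
  ((b * gamma a * X + - b * C_A a * Y) * u +
   (C_A a * X + b * gamma a * Y) * v) / (X ^+ 2 + b * Y ^+ 2) -
  ((1 * X + 0 * Y) * u + (0 * X + 1 * Y) * v)
    / (2 * pi * (X ^+ 2 + 1 * Y ^+ 2)).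
  by rewrite /flux_component !mul0r !mul1r addr0 add0r; congr (_ / _ - _); ring.
under eq_fun do rewrite fE; rewrite fE.
apply: cvgB; apply: cvgM => //; apply: cvgV => //.
- by rewrite gt_eqF.
- by rewrite mul1r !mulf_neq0// gt_eqF// pi_gt0.
- by apply: cvgM.
Qed.

(** * Traces on the interface rays *)

(** The sector into which [m] points determines [b]; the limit, in contrast, is
    the same for both sectors, because [x] is orthogonal to [(u, v)]. *)
Lemma cvg_one_sided_flux {R : realType} (a b x y u v m1 m2 : R) :
  0 < b -> x != 0 \/ y != 0 -> x * u + y * v = 0 ->
  (\forall h \near (0 : R)^'+,
    dot (modified_flux a (vec2 (x + h * m1) (y + h * m2))) (vec2 u v) =
    flux_component a b (x + h * m1) (y + h * m2) u v) ->
  one_sided (modified_flux a) (vec2 u v) (vec2 m1 m2) (vec2 x y) -->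
    C_A a * (x * v - y * u) / (x ^+ 2 + y ^+ 2).
Proof.
move=> b0 xy0 ort fE; rewrite /one_sided -(flux_component_normal _ b)//.
have := cvg_at_right_filter (cvg_flux_component a b x y m1 m2 u v b0 xy0).
apply: cvg_trans; apply: near_eq_cvg.
by near do rewrite scale_vec2 add_vec2; apply: filterS fE => h ->.
Unshelve. all: by end_near. Qed.

(** When [n] is a unit vector normal to [x], this is [C_A / |x|] if [n] points
    in the direction of increasing angle, and [- C_A / |x|] otherwise. *)
Definition normal_trace {R : realType} (a : R) (n x : 'cV[R]_2) : R :=
  C_A a * det2 x n / enorm x ^+ 2.

Lemma normal_trace_vec2 {R : realType} (a u v x y : R) :
  normal_trace a (vec2 u v) (vec2 x y) =
  C_A a * (x * v - y * u) / (x ^+ 2 + y ^+ 2).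
Proof. by rewrite /normal_trace enorm_sqr /det2 !mxE. Qed.

Lemma interface_vec2 {R : realType} (x : 'cV[R]_2) :
  interface x <-> exists r, 0 < r /\ (x = vec2 r 0 \/ x = vec2 0 r).
Proof.
have p0 : polar^~ 0 = vec2^~ 0 :> (R -> _).
  by apply/funext => r; rewrite /polar cos0 sin0 mulr0 mulr1.
have p1 : polar^~ (pi / 2) = vec2 0 :> (R -> _).
  by apply/funext => r; rewrite /polar cos_pihalf sin_pihalf mulr0 mulr1.
split=> [[r [t [r0 [->|->] ->]]]|[r [r0 [->|->]]]].
- by exists r; split=> //; left; rewrite -[LHS]/((polar^~ 0) r) p0.
- by exists r; split=> //; right; rewrite -[LHS]/((polar^~ (pi / 2)) r) p1.
- by exists r, 0; split=> //; [left|rewrite -[RHS]/((polar^~ 0) r) p0].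
- exists r, (pi / 2); split=> //; first by right.
  by rewrite -[RHS]/((polar^~ (pi / 2)) r) p1.
Qed.

(** A unit normal to an interface ray is a coordinate vector up to sign, so for
    [h > 0] the points [x + h *: m] stay in the open quadrant if [m] has a
    positive entry, and in one of the open half-planes [x < 0], [y < 0]
    otherwise. *)
Lemma cvg_interface_flux {R : realType} (a : R) (n m x : 'cV[R]_2) :
  0 < a -> enorm n = 1 -> m = n \/ m = - n -> interface x -> dot n x = 0 ->
  one_sided (modified_flux a) n m x --> normal_trace a n x.
Proof.
move=> a0 n1 mn /interface_vec2[r [r0 xE]]; have r1 : r != 0 by rewrite gt_eqF.
have : enorm n ^+ 2 = 1 by rewrite n1 expr1n.
move: mn; rewrite [n]vec2_coords [m]vec2_coords enorm_sqr opp_vec2.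
move: (n ord0 _) (n ord_max _) (m ord0 _) (m ord_max _) => u v m1 m2 mn uv1.
have h0 : \forall h \near (0 : R)^'+, 0 < h by exact: nbhs_right_gt.
case: xE => ->; rewrite dot_vec2 mulr0 ?add0r ?addr0 => /eqP;
    rewrite mulf_eq0 (negbTE r1) orbF normal_trace_vec2 => /eqP w0;
    rewrite w0 in mn uv1 *; rewrite expr0n/= ?add0r ?addr0 in uv1.
- have m10 : m1 = 0 by case: mn => /vec2_inj[-> _]; rewrite ?oppr0.
  have m2v : m2 = v \/ m2 = - v by case: mn => /vec2_inj[_ ->]; [left|right].
  have ort : r * 0 + 0 * v = 0 by ring.
  have [m20|m20|m20] := ltgtP 0 m2.
  + apply: (cvg_one_sided_flux _ a) => //; first by left.
    apply: filterS h0 => h h0; rewrite m10 modified_flux_quadrant//.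
      by rewrite mulr0 addr0.
    by rewrite add0r mulr_gt0.
  + apply: (cvg_one_sided_flux _ 1) => //; first by left.
    apply: filterS h0 => h h0; rewrite modified_flux_outside//; right.
    by rewrite add0r nmulr_llt0.
  + have v0 : v = 0.
      by case: m2v; rewrite -m20 => /eqP; rewrite eq_sym ?oppr_eq0 => /eqP.
    by move: uv1; rewrite v0 expr0n => /eqP; rewrite eq_sym oner_eq0.
- have m20 : m2 = 0 by case: mn => /vec2_inj[_ ->]; rewrite ?oppr0.
  have m1u : m1 = u \/ m1 = - u by case: mn => /vec2_inj[-> _]; [left|right].
  have ort : 0 * u + r * 0 = 0 by ring.
  have [m10|m10|m10] := ltgtP 0 m1.
  + apply: (cvg_one_sided_flux _ a) => //; first by right.
    apply: filterS h0 => h h0; rewrite m20 modified_flux_quadrant//.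
      by rewrite add0r mulr_gt0.
    by rewrite mulr0 addr0.
  + apply: (cvg_one_sided_flux _ 1) => //; first by right.
    apply: filterS h0 => h h0; rewrite modified_flux_outside//; left.
    by rewrite add0r nmulr_llt0.
  + have u0 : u = 0.
      by case: m1u; rewrite -m10 => /eqP; rewrite eq_sym ?oppr_eq0 => /eqP.
    by move: uv1; rewrite u0 expr0n => /eqP; rewrite eq_sym oner_eq0.
Qed.

(** The formula holds for the pointwise value and for the traces alike, so the
    edge integral does not distinguish interface rays from the others. *)
Lemma normal_component_trace {R : realType} (a : R) (n m x : 'cV[R]_2) :
  0 < a -> enorm n = 1 -> m = n \/ m = - n -> x != 0 -> dot n x = 0 ->
  normal_component interface (modified_flux a) n m x = normal_trace a n x.
Proof.
move=> a0 n1 mn x0 ort; rewrite /normal_component.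
case: ifPn => [/set_mem ix|/negP xN].
  by apply: cvg_lim; [exact: norm_hausdorff|exact: cvg_interface_flux].
have {}xN : ~ interface x by move=> /mem_set.
move: x0 ort xN; rewrite [x]vec2_coords [n]vec2_coords.
move: (n ord0 _) (n ord_max _) (x ord0 _) (x ord_max _) => u v y z x0.
rewrite dot_vec2 normal_trace_vec2 => ort xN.
have ort' : y * u + z * v = 0 by rewrite mulrC [z * v]mulrC.
have yz0 : y != 0 \/ z != 0.
  have [y0|] := eqVneq y 0; last by left.
  right; apply: contraNneq x0 => z0.
  by apply/eqP; rewrite y0 z0 [RHS]vec2_coords !mxE.
have [y0|y0|y0] := ltgtP y 0.
- by rewrite modified_flux_outside ?flux_component_normal//; left.
- have [z0|z0|z0] := ltgtP z 0.
  + by rewrite modified_flux_outside ?flux_component_normal//; right.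
  + by rewrite modified_flux_quadrant ?flux_component_normal.
  + exfalso; apply: xN; apply/interface_vec2; exists y.
    by split=> //; left; rewrite z0.
- have [z0|z0|z0] := ltgtP z 0.
  + by rewrite modified_flux_outside ?flux_component_normal//; right.
  + exfalso; apply: xN; apply/interface_vec2; exists z.
    by split=> //; right; rewrite y0.
  + by case: yz0; rewrite ?y0 ?z0 eqxx.
Qed.

Lemma C_A_neq0 {R : realType} (a : R) : 0 < a -> a != 1 -> C_A a != 0.
Proof.
move=> a0 a1; have p0 := @pi_gt0 R.
have s0 : 0 < Num.sqrt a by rewrite sqrtr_gt0.
have g0 : 0 < gamma a.
  rewrite /gamma invr_gt0 ltr_pwDl//.
    by rewrite divr_gt0// mulr_gt0// addr_gt0.
  have d0 : 0 < 2 * pi * (3 * Num.sqrt a + 1).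
    by rewrite !mulr_gt0// addr_gt0// mulr_gt0.
  by apply: divr_ge0 (ltW d0); rewrite mulr_ge0 ?sqr_ge0// ltW.
rewrite /C_A mulf_neq0 ?oppr_eq0 ?(lt0r_neq0 g0)// !mulf_neq0// ?invr_eq0.
- by rewrite lt0r_neq0.
- by rewrite ln_eq0.
- by rewrite lt0r_neq0// mulr_gt0// addr_gt0// mulr_gt0.
Qed.

(** * Divergence of the edge integral *)

Lemma integral_inv_itv01 {R : realType} (c : R) : 0 < c ->
  (\int[lebesgue_measure]_(t in `]0%R, 1%R[) (c / t)%:E = +oo)%E.
Proof.
move=> c0; apply/eqyP => A A0.
(* By this choice [c * (ln (1 / 2) - ln e) = A]. *)
pose e : R := expR (- (A / c)) / 2.
have e0 : 0 < e by rewrite divr_gt0 ?expR_gt0.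
have e1 : e < 1 / 2.
  by rewrite ltr_pM2r// expR_lt1 oppr_lt0 divr_gt0.
have cont (t : R) : 0 < t -> {for t, continuous (fun x : R => c / x)}.
  by move=> t0; apply: cvgM; [exact: cvg_cst|apply: cvgV; rewrite ?gt_eqF].
have ders (t : R) : 0 < t -> is_derive t (1 : R) (c \*: @ln R) (c / t).
  by move=> t0; have := is_derive1_ln t0 => dl; apply: is_derive_eq.
have cln (t : R) : 0 < t -> {for t, continuous (c \*: @ln R)}.
  move=> t0; have [/derivable1_diffP dl _] := ders t t0.
  exact: differentiable_continuous.
have <- : (\int[lebesgue_measure]_(t in `[e, (1 / 2)%R]) (c / t)%:E = A%:E)%E.
  rewrite (continuous_FTC2 (F := c \*: @ln R) e1).
  - rewrite -EFinB /=; congr (_%:E); rewrite /GRing.scale/= /e.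
    rewrite !ln_div ?posrE ?expR_gt0// ln1 expRK; field.
    by rewrite gt_eqF.
  - apply/continuous_within_itvP => //; split.
    + by move=> t /itvP h; apply: cont; rewrite (lt_trans e0)// h.
    + by apply: cvg_at_right_filter; exact: cont.
    + by apply: cvg_at_left_filter; apply: cont.
  - split.
    + move=> t /itvP h; have t0 : 0 < t by rewrite (lt_trans e0)// h.
      by have [] := ders t t0.
    + by apply: cvg_at_right_filter; exact: cln.
    + by apply: cvg_at_left_filter; apply: cln.
  - move=> t /itvP h; have t0 : 0 < t by rewrite (lt_trans e0)// h.
    by rewrite derive1E; have [_ ->] := ders t t0.
apply: ge0_subset_integral => //=.
- apply/measurable_EFinP; apply: open_continuous_measurable_fun => // t.
  by rewrite inE/= in_itv/= => /andP[t0 _]; exact: cont.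
- by move=> t; rewrite in_itv/= => /andP[t0 _]; rewrite lee_fin ltW// divr_gt0.
- move=> t; rewrite /= !in_itv/= => /andP[et t1]; apply/andP; split.
    exact: lt_le_trans et.
  by apply: le_lt_trans t1 _; lra.
Qed.

Lemma abs_normal_trace_pullback {R : realType} (a : R) (q n : 'cV[R]_2)
    (t : R) :
  q != 0 -> enorm n = 1 -> dot n q = 0 -> 0 < t ->
  `|normal_trace a n (t *: q)| * enorm q = `|C_A a| / t.
Proof.
move=> q0 n1 ort t0; have e0 := enorm_gt0 q q0.
have -> : normal_trace a n (t *: q) =
    C_A a * (t * det2 q n) / (t * enorm q) ^+ 2.
  rewrite [q]vec2_coords scale_vec2 /normal_trace.
  rewrite [(t * _) ^+ 2]exprMn !enorm_sqr.
  by rewrite /det2 !mxE/=; congr (_ * _ / _); ring.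
rewrite normrM normfV normrX !normrM det2_normal//.
rewrite (gtr0_norm t0) (gtr0_norm e0).
by field; rewrite !gt_eqF.
Qed.

Lemma poly_fun1 {R : realType} (k : nat) : poly_fun k.+1 (fun=> 1 : R).
Proof.
exists (fun i j => if (i == 0%N) && (j == 0%N) then 1 else 0) => x.
rewrite big_ord_recl subn0 big_ord_recl /= !expr0 !mulr1.
by rewrite !big1 ?addr0// => i _; rewrite ?big1// => *; rewrite !mul0r.
Qed.

Theorem proposition5p5 (R : realType) (a : R) (q n m : 'cV[R]_2) :
  0 < a -> a != 1 ->
  q != 0 -> open_segment 0 q `<=` Omega ->
  unit_normal 0 q n -> (m = n \/ m = - n) ->
  [/\ forall x, open_segment 0 q x -> interface x ->
        cvg (one_sided (modified_flux a) n m x),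
      edge_integral_abs 0 q
        (normal_component interface (modified_flux a) n m) = +oo%E,
      edge_flux interface 0 q n m (modified_flux a) = None,
      forall r : 'cV[R]_2, 0 < dot m r ->
        RT0_dofs interface 0 q r (edge_flux interface 0 q n m)
    & forall (k : nat) (r : 'cV[R]_2), (1 <= k)%N -> 0 < dot m r ->
        BDM_dofs interface k 0 q r (edge_flux interface 0 q n m)].
Proof.
move=> a0 a1 q0 _ nq mn; have [n1] := nq; rewrite subr0 => ort.
have seg (t : R) : segment_point 0 q t = t *: q.
  by rewrite /segment_point add0r subr0.
have dot_seg (t : R) : dot n (t *: q) = 0.
  rewrite /dot; under eq_bigr do rewrite mxE mulrCA.
  by rewrite -mulr_sumr -/(dot n q) ort mulr0.
have pull (t : R) : 0 < t -> arclength_pullback 0 q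
    (fun x => `|normal_component interface (modified_flux a) n m x|) t =
    `|C_A a| / t.
  move=> t0; rewrite /arclength_pullback seg subr0 normal_component_trace//.
    exact: abs_normal_trace_pullback.
  by rewrite scaler_eq0 negb_or gt_eqF.
have infinite : edge_integral_abs 0 q
    (normal_component interface (modified_flux a) n m) = +oo%E.
  rewrite -(integral_inv_itv01 `|C_A a|) ?normr_gt0 ?C_A_neq0//.
  apply: eq_integral => t; rewrite inE/= in_itv/= => /andP[t0 _].
  by rewrite pull.
have dof W r : W (fun=> 1) -> 0 < dot m r ->
    edge_moments interface W 0 q r (edge_flux interface 0 q n m).
  move=> W1 mr; exists 0, q, r, n, m, (fun=> 1); split=> //.
  - by rewrite inE eqxx.
  - by rewrite subr0.
split=> //.
- move=> x [t]; rewrite /= in_itv/= => /andP[t0 _] <- ix; apply/cvg_ex.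
  by exists (normal_trace a n (segment_point 0 q t)); apply: cvg_interface_flux;
    rewrite // seg.
- rewrite /edge_flux /edge_moment /partial_integral asboolF//.
  move=> /integrableP[_].
  set I := (X in (X < _)%E); suff -> : I = +oo%E by rewrite ltxx.
  rewrite -infinite.
  apply: eq_integral => t _; congr (_%:E).
  by rewrite /arclength_pullback mulr1 normrM (ger0_norm (enorm_ge0 _)).
- by move=> r mr; apply: dof.
- by move=> k r _ mr; left; left; apply: dof => //; exact: poly_fun1.
Qed.
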